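(* Let $X,Y,Z$ be real normed vector spaces, $K\subset Y$ a proper convex cone with $\operatorname{int}K\neq\emptyset$, $Q\subset Z$ a closed convex pointed cone, $F:X\rightrightarrows Y$ and $G:X\rightrightarrows Z$ set-valued maps, $\mathcal{E}_G:X\rightrightarrows Z$, $\mathcal{E}_G(x)=G(x)+Q$, and $A:=\mathcal{E}_G^{-1}(0)=\{x\in X\mid 0\in G(x)+Q\}$. Suppose that $(\overline{x},\overline{y})\in\operatorname{Gr}F\cap(A\times Y)$ is a local weak directional Pareto minimum point for $F$ on $A$ with respect to a closed nonempty set $L\subset S_X$. Let $\overline{z}\in G(\overline{x})\cap(-Q)$ and let $\emptyset\neq N\subset S_Z$ be a closed set. Moreover, suppose that $Q\cap S_Z\subset N$, that $\operatorname{cone}L$ and $\operatorname{cone}N$ are convex, and that $\mathcal{E}_G$ is directionally metric subregular at $(\overline{x},0)$ with respect to $L$ and $N$. Then $$\bigl\{(v,w)\mid \exists u\in X,\ v\in D_DF(\overline{x},\overline{y})(u),\ w\in D_B^{L,N}G(\overline{x},\overline{z})(u)\bigr\}\cap\bigl(-\operatorname{int}K\times(-Q)\bigr)=\emptyset .$$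
   Context: $S_X,S_Z$ are the unit spheres; $\operatorname{cone}C=\{tc\mid t\ge0,\ c\in C\}$; $\operatorname{Gr}F=\{(x,y)\mid y\in F(x)\}$. A convex cone $K$ is proper if $K\neq\{0\}$ and $K\neq Y$ (not necessarily pointed); $Q$ pointed means $Q\cap(-Q)=\{0\}$. Here $A$ is the constraint set of an optimization problem, for which the paper's standing assumption is that it is a closed nonempty set. Local weak directional Pareto minimum: $(\overline{x},\overline{y})\in\operatorname{Gr}F\cap(A\times Y)$ is a local weak directional Pareto minimum point for $F$ on $A$ with respect to $L$ if there is a neighborhood $U$ of $\overline{x}$ such that $\bigl(F(U\cap A\cap(\overline{x}+\operatorname{cone}L))-\overline{y}\bigr)\cap(-\operatorname{int}K)=\emptyset$. Dini lower derivative: $v\in D_DF(\overline{x},\overline{y})(u)$ iff for every $(t_n)\subset(0,\infty)$ with $t_n\to0$ and every $u_n\to u$ there is $v_n\to v$ such that $\overline{y}+t_nv_n\in F(\overline{x}+t_nu_n)$ for all $n\in\mathbb{N}$. Directional Bouligand derivative: $w\in D_B^{L,N}G(\overline{x},\overline{z})(u)$ iff there are $(u_n)\subset\operatorname{cone}L$ with $u_n\to u$, $(w_n)\subset\operatorname{cone}N$ with $w_n\to w$, and $(t_n)\subset(0,\infty)$ with $t_n\to0$ such that $\overline{z}+t_nw_n\in G(\overline{x}+t_nu_n)$ for all $n$. Directional minimal time function: $T_L(x,\Omega)=\inf\{t\ge0\mid \exists u\in L:\ x+tu\in\Omega\}$, with $\inf\emptyset=+\infty$; similarly $T_N$ in $Z$.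 Directional metric subregularity: $\mathcal{E}_G$ is directionally metric subregular at $(\overline{x},0)$ with respect to $L$ and $N$ if there are $\alpha>0$ and neighborhoods $U$ of $\overline{x}$, $V$ of $0$ such that for every $x\in U$, $T_L(x,\mathcal{E}_G^{-1}(0))\le\alpha T_N(0,\mathcal{E}_G(x)\cap V)$. *)

(* Defs.v *)
From HB Require Import structures.
From mathcomp Require Import all_boot all_order all_algebra.
From mathcomp Require Import all_classical all_reals all_analysis.
Import Order.TTheory GRing.Theory Num.Theory.
Import numFieldNormedType.Exports.

Set Implicit Arguments.
Unset Strict Implicit.
Unset Printing Implicit Defensive.

Local Open Scope classical_set_scope.
Local Open Scope ring_scope.

Definition unit_sphere (R : realType) (X : normedModType R) : set X :=
  [set x | `|x| = 1].
Arguments unit_sphere {R} X.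

Definition opp_set (V : zmodType) (C : set V) : set V := [set - c | c in C].

Definition cone (R : realType) (X : normedModType R) (C : set X) : set X :=
  [set t *: c | t in [set t : R | 0 <= t] & c in C].

Definition is_convex_cone (R : realType) (X : normedModType R) (C : set X) :
  Prop := cone C = C /\ convex_set C.

Definition proper_set (V : zmodType) (C : set V) : Prop :=
  C <> [set 0] /\ C <> setT.

Definition pointed (V : zmodType) (C : set V) : Prop :=
  C `&` opp_set C = [set 0].

Definition graph (X Y : Type) (F : X -> set Y) : set (X * Y) :=
  [set p | F p.1 p.2].

Definition inverse_map (X Y : Type) (F : X -> set Y) (y : Y) : set X :=
  [set x | F x y].

Definition image_map (X Y : Type) (F : X -> set Y) (S : set X) : set Y :=
  \bigcup_(x in S) F x.

Definition epi_map (X : Type) (Z : zmodType) (G : X -> set Z) (Q : set Z)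
  (x : X) : set Z := [set z + q | z in G x & q in Q].

Definition local_weak_dir_pareto_min (R : realType) (X Y : normedModType R)
  (K : set Y) (F : X -> set Y) (A L : set X) (xbar : X) (ybar : Y) : Prop :=
  (graph F `&` (A `*` setT)) (xbar, ybar) /\
  exists2 U : set X, nbhs xbar U &
    [set y - ybar | y in
       image_map F (U `&` A `&` [set xbar + d | d in cone L])]
    `&` opp_set (interior K) = set0.

Definition dini_lower_derivative (R : realType) (X Y : normedModType R)
  (F : X -> set Y) (xbar : X) (ybar : Y) (u : X) : set Y :=
  [set v | forall (t_ : nat -> R) (u_ : nat -> X),
     (forall n, 0 < t_ n) -> t_ @ \oo --> (0 : R) -> u_ @ \oo --> u ->
     exists2 v_ : nat -> Y, v_ @ \oo --> v &
       forall n, F (xbar + t_ n *: u_ n) (ybar + t_ n *: v_ n)].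

Definition dir_bouligand_derivative (R : realType) (X Z : normedModType R)
  (L : set X) (N : set Z) (G : X -> set Z) (xbar : X) (zbar : Z) (u : X) :
  set Z :=
  [set w | exists (u_ : nat -> X) (w_ : nat -> Z) (t_ : nat -> R),
     [/\ (forall n, cone L (u_ n)) /\ u_ @ \oo --> u,
         (forall n, cone N (w_ n)) /\ w_ @ \oo --> w,
         (forall n, 0 < t_ n) /\ t_ @ \oo --> (0 : R) &
         forall n, G (xbar + t_ n *: u_ n) (zbar + t_ n *: w_ n)]].

(* [ereal_inf set0 = +oo], and [alpha%:E * +oo = +oo] for [0 < alpha]. *)
Definition dir_min_time (R : realType) (X : normedModType R) (L : set X)
  (x : X) (Omega : set X) : \bar R :=
  ereal_inf [set t%:E | t in
    [set t : R | 0 <= t /\ exists2 u, L u & Omega (x + t *: u)]].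

Definition dir_metric_subregular (R : realType) (X Z : normedModType R)
  (L : set X) (N : set Z) (H : X -> set Z) (xbar : X) (zbar : Z) : Prop :=
  exists (alpha : R) (U : set X) (V : set Z),
    [/\ 0 < alpha, nbhs xbar U, nbhs zbar V &
        forall x, U x ->
          (dir_min_time L x (inverse_map H zbar)
           <= alpha%:E * dir_min_time N zbar (H x `&` V))%E].

(* Main.v *)
(* Let [(v, w)] with [v \in - int K], [w \in - Q] come from a direction [u], and let
   [u_n], [w_n], [t_n] realize [w].  Adding [- zbar - t_n w \in Q] to
   [zbar + t_n w_n] shows [t_n (w_n - w) \in E_G (xbar + t_n u_n)], and
   [w_n - w \in cone N] because [- w \in Q `<=` cone N] and [cone N] is convex.
   Hence the time to reach [E_G (xbar + t_n u_n)] from [0] along [N] is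
   [o(t_n)], and subregularity yields corrections [e_n \in cone L], [e_n --> 0],
   with [xbar + t_n (u_n + e_n) \in A].  The Dini derivative, tested along
   [u_n + e_n --> u], then produces points of [ybar + t_n (- int K)] in the
   image of [F], against minimality. *)
Require Import Defs.
From HB Require Import structures.
From mathcomp Require Import all_boot all_order all_algebra.
From mathcomp Require Import all_classical all_reals all_analysis.
Import Order.TTheory GRing.Theory Num.Theory.
Import numFieldNormedType.Exports.

Set Implicit Arguments.
Unset Strict Implicit.
Unset Printing Implicit Defensive.

Local Open Scope classical_set_scope.
Local Open Scope ring_scope.

Lemma cone_scale (R : realType) (X : normedModType R) (C : set X) (t : R)
  (x : X) : 0 <= t -> cone C x -> cone C (t *: x).
Proof.
move=> t0 [s /= s0 [c Cc <-]]; exists (t * s); first exact: mulr_ge0.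
by exists c => //; rewrite scalerA.
Qed.

(** The sum is twice the midpoint, which convexity keeps in the cone. *)
Lemma cone_add (R : realType) (X : normedModType R) (C : set X) :
  convex_set (cone C) -> forall x y, cone C x -> cone C y -> cone C (x + y).
Proof.
move=> cvxC x y Cx Cy.
have h0 : 0 <= 2^-1 :> R by rewrite invr_ge0.
have h1 : 2^-1 <= 1 :> R by rewrite invf_le1// ler1n.
have /set_mem := cvxC x y (Itv01 h0 h1) (mem_set Cx) (mem_set Cy).
move=> /(cone_scale (ler0n R 2)).
rewrite /conv/= /unstable.onem [X in X - _]splitr mul1r addrK -scalerDr scalerA.
by rewrite divff ?pnatr_eq0// scale1r.
Qed.

Lemma convex_cone_scale (R : realType) (X : normedModType R) (Q : set X)
  (t : R) (x : X) : is_convex_cone Q -> 0 <= t -> Q x -> Q (t *: x).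
Proof. by case=> <- _; exact: cone_scale. Qed.

Lemma convex_cone_add (R : realType) (X : normedModType R) (Q : set X)
  (x y : X) : is_convex_cone Q -> Q x -> Q y -> Q (x + y).
Proof. by case=> <- cvx; exact: cone_add. Qed.

(** A nonzero [x] is [|x|] times its normalization, a point of [N]. For [x = 0] any point of [N],
    scaled by zero, serves. *)
Lemma sub_cone_sphere (R : realType) (X : normedModType R) (Q N : set X) :
  is_convex_cone Q -> N !=set0 -> Q `&` unit_sphere X `<=` N -> Q `<=` cone N.
Proof.
move=> Qcone [n Nn] QN x Qx; have [->|x0] := eqVneq x 0.
  by exists 0 => //=; exists n => //; rewrite scale0r.
exists `|x| => /=; first exact: normr_ge0.
exists (`|x|^-1 *: x); last by rewrite scalerA divff ?normr_eq0// scale1r.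
apply: QN; split; first by apply: convex_cone_scale.
by rewrite /unit_sphere/= normrZ normfV normr_id mulVf ?normr_eq0.
Qed.

(** Scaling by [t > 0] carries neighborhoods of [x] to neighborhoods of [t *: x] and maps [K] into
    itself. *)
Lemma interior_cone_scale (R : realType) (X : normedModType R) (K : set X)
  (t : R) (x : X) :
  is_convex_cone K -> 0 < t -> interior K x -> interior K (t *: x).
Proof.
move=> Kcone t0 /(nbhsZ (lt0r_neq0 t0)); apply: filterS => _ [y Ky <-].
exact: convex_cone_scale (ltW t0) Ky.
Qed.

(** Along unit directions, travel time is the length of the displacement. *)
Lemma dir_min_time_le_norm (R : realType) (X : normedModType R) (L : set X)
  (x d : X) (Omega : set X) :
  L `<=` unit_sphere X -> cone L d -> Omega (x + d) ->
  (dir_min_time L x Omega <= `|d|%:E)%E.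
Proof.
move=> LS [t /= t0 [l Ll <-]] xd; apply: ereal_inf_lbound.
exists t; first by split=> //; exists l.
by rewrite normrZ (LS _ Ll) mulr1 ger0_norm.
Qed.

(** The infimum need not be attained, so a strict bound is what yields an actual displacement. *)
Lemma dir_min_time_lt (R : realType) (X : normedModType R) (L : set X)
  (x : X) (Omega : set X) (r : R) :
  L `<=` unit_sphere X -> (dir_min_time L x Omega < r%:E)%E ->
  exists d, [/\ cone L d, `|d| < r & Omega (x + d)].
Proof.
move=> LS /ereal_inf_lt[_ [t [t0 [l Ll xl] <-]]]; rewrite lte_fin => tr.
exists (t *: l); split=> //; first by exists t => //; exists l.
by rewrite normrZ (LS _ Ll) mulr1 ger0_norm.
Qed.

(** Turns the directions realizing [w] into eventually feasible ones with the same limit [u], ready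
    for the Dini derivative. *)
Lemma subregular_correction (R : realType) (X Z : normedModType R)
  (Q : set Z) (G : X -> set Z) (L : set X) (N : set Z) (xbar u : X)
  (zbar w : Z) :
  is_convex_cone Q -> L !=set0 -> L `<=` unit_sphere X ->
  Q (- zbar) -> Q (- w) -> N !=set0 -> N `<=` unit_sphere Z ->
  Q `&` unit_sphere Z `<=` N ->
  convex_set (cone L) -> convex_set (cone N) ->
  dir_metric_subregular L N (epi_map G Q) xbar 0 ->
  dir_bouligand_derivative L N G xbar zbar u w ->
  exists (u_ : nat -> X) (t_ : nat -> R),
    [/\ forall n, cone L (u_ n), u_ @ \oo --> u,
        forall n, 0 < t_ n, t_ @ \oo --> (0 : R) &
        \forall n \near \oo,
          inverse_map (epi_map G Q) 0 (xbar + t_ n *: u_ n)].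
Proof.
move=> Qcone [l0 Ll0] LS Qz Qw Nn0 NS QN cvxL cvxN [a [U [V [a0 nU nV sub]]]].
move=> [u_ [w_ [t_ [[Lu cu] [Nw cw] [t0 ct] Gn]]]].
have cx : xbar + t_ n *: u_ n @[n --> \oo] --> xbar.
  have := cvgD (cvg_cst xbar) (cvgZ ct cu).
  by rewrite scale0r addr0; apply.
have cd : w_ n - w @[n --> \oo] --> 0.
  by have := cvgB cw (cvg_cst w); rewrite subrr; apply.
have cz : t_ n *: (w_ n - w) @[n --> \oo] --> 0.
  by have := cvgZ ct cd; rewrite scale0r; apply.
(* The bound for the corrections. The summand [t_ n] keeps the time estimate below strict even when
   [w_ n = w], and still tends to zero. *)
pose r n := a * `|w_ n - w| + t_ n.
have cr : r n @[n --> \oo] --> 0.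
  have := cvgD (cvgMl_tmp (a := a) (cvg_norm cd)) ct.
  by rewrite normr0 mulr0 addr0; apply.
have r0 n : 0 <= r n by rewrite addr_ge0 ?mulr_ge0// ltW.
(* For the finitely many [n] outside [U] and [V], [e = 0] will do. *)
have corr n : exists e, [/\ cone L e, `|e| <= r n &
    U (xbar + t_ n *: u_ n) -> V (t_ n *: (w_ n - w)) ->
    inverse_map (epi_map G Q) 0 (xbar + t_ n *: (u_ n + e))].
  have [[Ux Vz]|nUV] := pselect (U (xbar + t_ n *: u_ n) /\
                                 V (t_ n *: (w_ n - w))); last first.
    exists 0; split; last by move=> Ux Vz; case: nUV.
      by exists 0 => //=; exists l0 => //; rewrite scale0r.
    by rewrite normr0.
  have Ez : epi_map G Q (xbar + t_ n *: u_ n) (t_ n *: (w_ n - w)).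
    exists (zbar + t_ n *: w_ n) => //.
    exists (- zbar + t_ n *: - w); last by rewrite addrACA subrr add0r scalerDr.
    apply: convex_cone_add => //.
    exact: convex_cone_scale Qcone (ltW (t0 n)) Qw.
  have Nz : cone N (t_ n *: (w_ n - w)).
    apply: cone_scale; first exact: ltW.
    by apply: cone_add => //; exact: (sub_cone_sphere Qcone Nn0 QN).
  have TN : (dir_min_time N 0%R (epi_map G Q (xbar + t_ n *: u_ n)%R `&` V)
      <= `|t_ n *: (w_ n - w)|%R%:E)%E.
    by apply: dir_min_time_le_norm => //; rewrite add0r.
  have TL : (dir_min_time L (xbar + t_ n *: u_ n)%R
      (inverse_map (epi_map G Q) 0%R) < (t_ n * r n)%:E)%E.
    apply: le_lt_trans (sub _ Ux) _.
    apply: (@le_lt_trans _ _ (a%:E * `|t_ n *: (w_ n - w)|%R%:E)%E).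
      by rewrite lee_pmul2l ?lte_fin.
    rewrite -EFinM lte_fin normrZ gtr0_norm// mulrCA ltr_pM2l//.
    by rewrite ltrDl.
  have [d [Ld dr Ad]] := dir_min_time_lt LS TL.
  (* Since [|d| < t_ n * r n], dividing by [t_ n] leaves a correction of norm at most [r n]. *)
  exists ((t_ n)^-1 *: d); split.
  - by apply: cone_scale => //; rewrite invr_ge0 ltW.
  - rewrite normrZ normfV gtr0_norm// mulrC ler_pdivrMr// mulrC.
    exact: ltW.
  - by move=> _ _; rewrite scalerDr scalerA divff ?gt_eqF// scale1r addrA.
have [e_ He] := choice corr.
have ce : e_ @ \oo --> 0.
  apply: norm_cvg0; apply: (squeeze_cvgr _ (cvg_cst (0 : R)) cr).
  by apply: nearW => n; rewrite normr_ge0/=; have [] := He n.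
exists (fun n => u_ n + e_ n), t_; split=> //.
- by move=> n; apply: cone_add => //; have [] := He n.
- by have := cvgD cu ce; rewrite addr0; apply.
- near=> n; have [_ _] := He n; apply.
  + by near: n; apply: cx.
  + by near: n; apply: cz.
Unshelve. all: by end_near.
Qed.

Theorem proposition3p8 (R : realType) (X Y Z : normedModType R)
  (K : set Y) (Q : set Z) (F : X -> set Y) (G : X -> set Z)
  (L : set X) (N : set Z) (xbar : X) (ybar : Y) (zbar : Z)
  (K_cone : is_convex_cone K) (K_proper : proper_set K)
  (intK_neq0 : interior K !=set0)
  (Q_cone : is_convex_cone Q) (Q_closed : closed Q) (Q_pointed : pointed Q)
  (A := inverse_map (epi_map G Q) 0)
  (A_closed : closed A) (A_neq0 : A !=set0)
  (L_closed : closed L) (L_neq0 : L !=set0) (L_sphere : L `<=` unit_sphere X)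
  (xy_min : local_weak_dir_pareto_min K F A L xbar ybar)
  (zbar_in : (G xbar `&` opp_set Q) zbar)
  (N_neq0 : N !=set0) (N_sphere : N `<=` unit_sphere Z) (N_closed : closed N)
  (QN : Q `&` unit_sphere Z `<=` N)
  (coneL_convex : convex_set (cone L)) (coneN_convex : convex_set (cone N))
  (G_subreg : dir_metric_subregular L N (epi_map G Q) xbar 0) :
  [set vw : Y * Z | exists u : X,
     dini_lower_derivative F xbar ybar u vw.1 /\
     dir_bouligand_derivative L N G xbar zbar u vw.2]
  `&` (opp_set (interior K) `*` opp_set Q) = set0.
Proof.
rewrite -subset0 => -[v w] [[u [/= Dv Bw]] [[k Kk kv] [q Qq qw]]].
have Qw : Q (- w) by rewrite -qw/= opprK.
have Qz : Q (- zbar) by case: zbar_in => _ [q' Qq' <-]; rewrite opprK.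
have [u_ [t_ [Lu cu t0 ct Au]]] := subregular_correction Q_cone L_neq0 L_sphere
  Qz Qw N_neq0 N_sphere QN coneL_convex coneN_convex G_subreg Bw.
have [v_ cv Fv] := Dv t_ u_ t0 ct cu.
case: xy_min => _ [U nU].
rewrite -subset0 => empty.
have cx : xbar + t_ n *: u_ n @[n --> \oo] --> xbar.
  have := cvgD (cvg_cst xbar) (cvgZ ct cu).
  by rewrite scale0r addr0; apply.
have cNv : - v_ n @[n --> \oo] --> k.
  by have := cvgN cv; rewrite -kv opprK; apply.
(* The interior is open, so [- v_ n] eventually lies in [interior K] itself, not merely in [K]. *)
have nK : nbhs k (interior K).
  by apply: open_nbhs_nbhs; split=> //; exact: open_interior.
near \oo => n.
(* This is the increment from [ybar] to a value of [F] at a feasible point near [xbar], and its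
   opposite lies in [interior K]. *)
apply: (empty (t_ n *: v_ n)); split.
  exists (ybar + t_ n *: v_ n); last by rewrite addrAC subrr add0r.
  exists (xbar + t_ n *: u_ n) => //; split; last first.
    by exists (t_ n *: u_ n) => //; apply: cone_scale => //; exact: ltW.
  split; first by near: n; apply: cx.
  by near: n.
exists (t_ n *: - v_ n); last by rewrite scalerN opprK.
apply: interior_cone_scale => //.
by near: n; apply: cNv.
Unshelve. all: by end_near.
Qed.
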